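(* Let $\mathcal{X}\in\mathbb{R}^{I_1\times I_2\times\cdots\times I_d}$ with $I_n\le\prod_{k\neq n}I_k$ for $n=1,2,\ldots,d$, and let $(r_1,\ldots,r_d)$ and $(\widehat r_1,\ldots,\widehat r_d)$ be positive integers with $\widehat r_n\le r_n\le I_n$ for every $n$. Let the matrices $C_n\in\mathbb{R}^{I_n\times r_n}$, $n=1,\ldots,d$, and the core tensor $\mathcal{G}\in\mathbb{R}^{r_1\times\cdots\times r_d}$ be computed by the L-DEIM based HOID algorithm (described in the context) applied to $\mathcal{X}$ with target multilinear rank $(r_1,\ldots,r_d)$ and parameters $(\widehat r_1,\ldots,\widehat r_d)$. Then $$\left\|\mathcal{X}-\mathcal{G}\times_1C_1\times_2C_2\cdots\times_dC_d\right\|_F^2\le\sum_{n=1}^d\left[I_n\left(\prod_{k\neq n}I_k\right)\frac{4^{\widehat r_n}\cdot\widehat r_n}{3}\right]\sigma_{\widehat r_n+1}^2,$$ where $\sigma_{\widehat r_n+1}$ (in the $n$th summand) is the $(\widehat r_n+1)$th largest singular value of the mode-$n$ unfolding $X_{(n)}$.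
   Context: Tensor notation. For a real $d$-dimensional tensor $\mathcal{X}\in\mathbb{R}^{I_1\times\cdots\times I_d}$, $\|\mathcal{X}\|_F$ is the square root of the sum of squares of its entries, and $X_{(n)}\in\mathbb{R}^{I_n\times\prod_{k\neq n}I_k}$ is its mode-$n$ unfolding (the matrix whose columns are the mode-$n$ fibers). For $U\in\mathbb{R}^{k\times I_n}$, the $n$-mode product $\mathcal{Y}=\mathcal{X}\times_nU$ is the tensor with $\mathcal{Y}_{i_1\ldots i_{n-1}\,i\,i_{n+1}\ldots i_d}=\sum_{i_n}x_{i_1\ldots i_d}u_{i i_n}$, i.e. $Y_{(n)}=UX_{(n)}$. $C^\dagger$ is the Moore-Penrose inverse of $C$. Matrices are indexed in MATLAB notation: $A(:,\mathbf{s})$ is the submatrix of columns indexed by $\mathbf{s}$, and $A\backslash b$ is the solution of the linear system with matrix $A$ and right-hand side $b$. $\|\cdot\|$ is the vector 2-norm. Singular values with index exceeding the smaller matrix dimension are taken to be $0$. L-DEIM selection of $k$ indices from a matrix $W\in\mathbb{R}^{N\times\widehat k}$, $\widehat k\le k\le N$: for $j=1,\ldots,\widehat k$, set $\mathbf{s}(j)=\operatorname{argmax}_{1\le i\le N}|W(i,j)|$ and then (if $j<\widehat k$) overwrite $W(:,j+1)$ by $W(:,j+1)-W(:,1{:}j)\,\bigl(W(\mathbf{s},1{:}j)\backslash W(\mathbf{s},j+1)\bigr)$, where $\mathbf{s}=(\mathbf{s}(1),\ldots,\mathbf{s}(j))$. Afterwards compute $\ell_i=\|W(i,:)\|$ for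 $i=1,\ldots,N$ using the overwritten $W$, discard the indices already in $\mathbf{s}$, and append to $\mathbf{s}$ the $k-\widehat k$ remaining indices with the largest values $\ell_i$. The output is the vector $\mathbf{s}$ of $k$ distinct indices. L-DEIM based HOID algorithm: for each $n=1,\ldots,d$, let $W_n\in\mathbb{R}^{\prod_{k\neq n}I_k\times\widehat r_n}$ have as columns the $\widehat r_n$ leading right singular vectors of $X_{(n)}$; apply L-DEIM to $W_n$ to select $r_n$ indices $\mathbf{s}$; set $C_n=X_{(n)}(:,\mathbf{s})$. Finally set $\mathcal{G}=\mathcal{X}\times_1C_1^\dagger\times_2C_2^\dagger\cdots\times_dC_d^\dagger$. *)

(* Defs.v *)
From HB Require Import structures.
From mathcomp Require Import all_boot all_order all_algebra.
From mathcomp Require Import reals.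

Set Implicit Arguments.
Unset Strict Implicit.
Unset Printing Implicit Defensive.

Import Order.TTheory GRing.Theory Num.Theory.
Local Open Scope ring_scope.

(* Modes, indices and singular values are all numbered from 0. *)

Section Tensor.
Variables (R : realType) (d : nat).
Implicit Types (I J : 'I_d -> nat) (n : 'I_d).

Definition midx I := {dffun forall n : 'I_d, 'I_(I n)}.

Definition tensor I := {ffun midx I -> R}.

Definition frob I (X : tensor I) : R := Num.sqrt (\sum_i X i ^+ 2).

(* Multi-indices with the n-th coordinate left out; they index the mode-n
   fibers. *)
Definition cidx I n :=
  {dffun forall k : {k : 'I_d | k != n}, 'I_(I (val k))}.

Lemma card_cidx I n : #|cidx I n| = (\prod_(k < d | k != n) I k)%N.
Proof.
rewrite card_dep_ffun foldrE big_map big_enum /=.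
rewrite (reindex_omap (val : {k : 'I_d | k != n} -> 'I_d) insub) /=;
  last first.
  by move=> k kn; rewrite insubT.
apply: eq_big => [k|k _]; last by rewrite card_ord.
by rewrite (valP k) valK eqxx.
Qed.

(* The multi-index with n-th coordinate a and remaining coordinates j. *)
Definition mode_join I n (a : 'I_(I n)) (j : cidx I n) : midx I :=
  [ffun k => match eq_comparable k n with
             | left kn => cast_ord (congr1 I (esym kn)) a
             | right kn => j (exist _ k (introN eqP kn))
             end].

(* The columns are the mode-n fibers, in the order of [enum (cidx I n)]. *)
Definition unfold I (X : tensor I) n :
    'M[R]_(I n, \prod_(k < d | k != n) I k) :=
  \matrix_(a, j)
     X (mode_join a (enum_val (cast_ord (esym (card_cidx I n)) j))).

Definition set_dim I n (k : nat) : 'I_d -> nat :=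
  fun m => if m == n then k else I m.

Lemma set_dim_eq I n k : set_dim I n k n = k.
Proof. by rewrite /set_dim eqxx. Qed.

Lemma set_dim_neq I n k m : m != n -> set_dim I n k m = I m.
Proof. by rewrite /set_dim => /negPf ->. Qed.

Definition mode_rest I n k (i : midx (set_dim I n k)) : cidx I n :=
  [ffun m => cast_ord (set_dim_neq I k (valP m)) (i (val m))].

Definition mode_prod I n k (X : tensor I) (U : 'M[R]_(k, I n)) :
    tensor (set_dim I n k) :=
  [ffun i => \sum_(a < I n) X (mode_join a (mode_rest i)) *
                            U (cast_ord (set_dim_eq I n k) (i n)) a].

Definition tensor_cast I J (eIJ : I =1 J) (X : tensor I) : tensor J :=
  [ffun j : midx J =>
     X ([ffun m => cast_ord (esym (eIJ m)) (j m)] : midx I)].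

(* Dimensions after the modes m < t have been changed from I m to J m. *)
Definition mixed_dim I J (t : nat) : 'I_d -> nat :=
  fun m => if (m < t)%N then J m else I m.

Lemma mixed_dim_at I J n : mixed_dim I J n n = I n.
Proof. by rewrite /mixed_dim ltnn. Qed.

Lemma mixed_dim0 I J : I =1 mixed_dim I J 0.
Proof. by []. Qed.

Lemma mixed_dimS I J n :
  set_dim (mixed_dim I J n) n (J n) =1 mixed_dim I J n.+1.
Proof.
move=> m; rewrite /set_dim /mixed_dim ltnS [(m <= n)%N]leq_eqVlt -val_eqE /=.
by case: eqP => [/val_inj ->|].
Qed.

Lemma mixed_dim_all I J : mixed_dim I J d =1 J.
Proof. by move=> m; rewrite /mixed_dim ltn_ord. Qed.

Section MultiProd.
Variables (I J : 'I_d -> nat) (X : tensor I).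
Variable U : forall n, 'M[R]_(J n, I n).

(* The product of X with U in the first t modes, one mode after the other. *)
Fixpoint multi_prod_upto (t : nat) : (t <= d)%N -> tensor (mixed_dim I J t) :=
  match t with
  | 0 => fun _ => tensor_cast (mixed_dim0 I J) X
  | t'.+1 => fun t'd =>
      let n := Ordinal t'd in
      tensor_cast (mixed_dimS I J n)
        (mode_prod (multi_prod_upto (ltnW t'd))
                   (castmx (erefl, esym (mixed_dim_at I J n)) (U n)))
  end.

Definition multi_prod : tensor J :=
  tensor_cast (mixed_dim_all I J) (multi_prod_upto (leqnn d)).

End MultiProd.

End Tensor.

Section Matrix.
Variable R : realType.

(* A = U diag(s) V^T; s i is the (i+1)-th largest singular value of A, and is
   0 once i reaches the smaller dimension of A. *)
Definition is_svd m n (A : 'M[R]_(m, n))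
    (U : 'M[R]_m) (s : nat -> R) (V : 'M[R]_n) : Prop :=
  [/\ U^T *m U = 1%:M,
      V^T *m V = 1%:M,
      (forall i, 0 <= s i) /\ {homo s : i j / (i <= j)%N >-> j <= i},
      forall i, (minn m n <= i)%N -> s i = 0
    & A = U *m (\matrix_(i < m, j < n) (s i *+ (i == j :> nat))) *m V^T].

Definition singular_values m n (A : 'M[R]_(m, n)) (s : nat -> R) : Prop :=
  exists U V, is_svd A U s V.

Definition leading_right_singular_vectors m n k (A : 'M[R]_(m, n))
    (W : 'M[R]_(n, k)) : Prop :=
  exists U s V (kn : (k <= n)%N),
    is_svd A U s V /\ W = colsub (widen_ord kn) V.

Definition is_moore_penrose m n (A : 'M[R]_(m, n)) (B : 'M[R]_(n, m)) : Prop :=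
  [/\ A *m B *m A = A, B *m A *m B = B,
      (A *m B)^T = A *m B & (B *m A)^T = B *m A].

Definition row_norm N k (W : 'M[R]_(N, k)) (i : 'I_N) : R :=
  Num.sqrt (\sum_j W i j ^+ 2).

Section LDEIM.
Variables (N kh k : nat) (kh_le_k : (kh <= k)%N).
Variable s : 'I_k -> 'I_N.

(* Overwrites column j using the j columns before it and the first j selected
   indices. *)
Definition deim_overwrite (W : 'M[R]_(N, kh)) (j : 'I_kh) : 'M[R]_(N, kh) :=
  let j_le_kh := ltnW (ltn_ord j) in
  let sj (i : 'I_j) := s (widen_ord (leq_trans j_le_kh kh_le_k) i) in
  let Wj := colsub (widen_ord j_le_kh) W in
  let c := invmx (rowsub sj Wj) *m rowsub sj (col j W) in
  \matrix_(i, l) if l == j then (col j W - Wj *m c) i 0 else W i l.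

(* The matrix W after t passes through the loop; the last pass (t = kh)
   overwrites nothing, since [insub] then returns [None]. *)
Fixpoint deim_state (W : 'M[R]_(N, kh)) (t : nat) : 'M[R]_(N, kh) :=
  if t is t'.+1 then
    let W' := deim_state W t' in
    if insub t is Some j then deim_overwrite W' j else W'
  else W.

(* s is a possible output of L-DEIM on W: all ways of breaking ties in the
   maximizations, and all orders of the appended indices, are allowed. *)
Definition ldeim (W : 'M[R]_(N, kh)) : Prop :=
  let ell := row_norm (deim_state W kh) in
  [/\ forall (j : 'I_kh) (i : 'I_N),
        `|deim_state W j i j|
          <= `|deim_state W j (s (widen_ord kh_le_k j)) j|,
      forall p q : 'I_k, (kh <= p)%N -> s q = s p -> q = p
    & forall (p : 'I_k) (i : 'I_N), (kh <= p)%N ->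
        (forall q, s q != i) -> ell i <= ell (s p)].

End LDEIM.

End Matrix.

(* C and G are a possible output of the L-DEIM based HOID algorithm. *)
Definition hoid (R : realType) (d : nat) (I r rh : 'I_d -> nat)
    (rh_le_r : forall n, (rh n <= r n)%N) (X : tensor R I)
    (C : forall n, 'M[R]_(I n, r n)) (G : tensor R r) : Prop :=
  (forall n,
     exists (W : 'M[R]_(\prod_(k < d | k != n) I k, rh n))
            (s : 'I_(r n) -> 'I_(\prod_(k < d | k != n) I k)),
       [/\ leading_right_singular_vectors (unfold X n) W,
           ldeim (rh_le_r n) s W
         & C n = colsub s (unfold X n)]) /\
  (exists2 P : forall n, 'M[R]_(r n, I n),
     forall n, is_moore_penrose (C n) (P n) & G = multi_prod X P).

(* Main.v *)
(* The multilinear projection error splits over the modes: with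
   Q_n = C_n C_n^+ an orthogonal projection, peeling off one mode at a time
   gives mutually orthogonal summands, so the squared error is at most the sum
   of the squared norms of (1 - Q_n) X_(n).

   For one mode, let A = X_(n), W its kh leading right singular vectors, S the
   column selection of the first kh L-DEIM indices and E = A (1 - W W^T).  Since
   S^T W has an inverse B and (1 - Q_n) A S = 0, the error is at most
   |A - A S B^T W^T|^2 = |E - E S B^T W^T|^2 = |E|^2 + |E S B^T|^2, because
   E W = 0.  This is at most (I_n - 1 + |B|^2) sigma_(kh+1)^2.

   To bound |B|, normalize the columns of the final L-DEIM state by their
   maximal entries.  This gives Y = W K with all entries at most 1 in absolute
   value, and S^T Y = L unit lower triangular.  So B = K L^-1, where
   |K|^2 = |Y|^2 <= N kh, and the rows of L^-1 have 1-norms at most 1, 2, 4, ...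
   so that |L^-1|^2 <= 4^kh / 3. *)

Require Import Defs.
From mathcomp Require Import all_boot all_order all_algebra.
From mathcomp Require Import reals.
From mathcomp Require Import ring lra.

Set Implicit Arguments.
Unset Strict Implicit.
Unset Printing Implicit Defensive.

Import Order.TTheory GRing.Theory Num.Theory.
Local Open Scope ring_scope.

(** * Frobenius norm *)

Definition fnorm2 {R : realType} {m n} (A : 'M[R]_(m, n)) : R :=
  \sum_i \sum_j A i j ^+ 2.

Section FrobeniusNorm.
Context {R : realType}.

Lemma fnorm2E m n (A : 'M[R]_(m, n)) : fnorm2 A = \tr (A^T *m A).
Proof.
rewrite /fnorm2 exchange_big; apply: eq_bigr => j _; rewrite mxE.
by apply: eq_bigr => i _; rewrite mxE expr2.
Qed.

Lemma fnorm2_ge0 m n (A : 'M[R]_(m, n)) : 0 <= fnorm2 A.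
Proof. by apply: sumr_ge0 => i _; apply: sumr_ge0 => j _; exact: sqr_ge0. Qed.

Lemma fnorm2_tr m n (A : 'M[R]_(m, n)) : fnorm2 A^T = fnorm2 A.
Proof.
rewrite /fnorm2 exchange_big; apply: eq_bigr => i _.
by apply: eq_bigr => j _; rewrite mxE.
Qed.

(** Pythagoras: by the trace formula the cross terms are the traces of [A^T *m B] and of its
    transpose. *)
Lemma fnorm2D m n (A B : 'M[R]_(m, n)) :
  A^T *m B = 0 -> fnorm2 (A + B) = fnorm2 A + fnorm2 B.
Proof.
move=> AB0; have BA0 : B^T *m A = 0.
  by rewrite -[LHS]trmxK trmx_mul trmxK AB0 trmx0.
rewrite !fnorm2E [(A + B)^T]linearD /= mulmxDl !mulmxDr AB0 BA0.
by rewrite addr0 add0r linearD.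
Qed.

Lemma fnorm2N m n (A : 'M[R]_(m, n)) : fnorm2 (- A) = fnorm2 A.
Proof.
by apply: eq_bigr => i _; apply: eq_bigr => j _; rewrite mxE sqrrN.
Qed.

Lemma fnorm2_isometry m n p (U : 'M[R]_(m, n)) (A : 'M[R]_(n, p)) :
  U^T *m U = 1%:M -> fnorm2 (U *m A) = fnorm2 A.
Proof.
by move=> UU; rewrite !fnorm2E trmx_mul mulmxA -(mulmxA A^T) UU mulmx1.
Qed.

(** Lagrange's identity: the double sum of the squares of [a i * b j - a j * b i] is twice the gap
    between the two sides. *)
Lemma sum_cauchy_schwarz (T : finType) (a b : T -> R) :
  (\sum_i a i * b i) ^+ 2 <= (\sum_i a i ^+ 2) * (\sum_i b i ^+ 2).
Proof.
have : 0 <= \sum_i \sum_j (a i * b j - a j * b i) ^+ 2.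
  by apply: sumr_ge0 => i _; apply: sumr_ge0 => j _; exact: sqr_ge0.
suff -> : \sum_i \sum_j (a i * b j - a j * b i) ^+ 2 =
    2 * ((\sum_i a i ^+ 2) * (\sum_i b i ^+ 2) - (\sum_i a i * b i) ^+ 2).
  by rewrite pmulr_rge0 // subr_ge0.
rewrite mulrBr mulr2n !mulrDl !mul1r opprD addrACA -addrA.
rewrite {2}[_ * (\sum_i b i ^+ 2)]mulrC expr2 !big_distrlr /= -!sumrN -!big_split.
rewrite /=; apply: eq_bigr => i _; rewrite -!sumrN -!big_split.
by rewrite /=; apply: eq_bigr => j _; ring.
Qed.

Lemma fnorm2M m n p (A : 'M[R]_(m, n)) (B : 'M[R]_(n, p)) :
  fnorm2 (A *m B) <= fnorm2 A * fnorm2 B.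
Proof.
rewrite -(fnorm2_tr B) /fnorm2 mulr_suml; apply: ler_sum => i _.
rewrite mulr_sumr; apply: ler_sum => j _.
rewrite mxE (le_trans (sum_cauchy_schwarz _ _))// ler_wpM2l //.
  by apply: sumr_ge0 => k _; exact: sqr_ge0.
by apply: ler_sum => k _; rewrite mxE.
Qed.

(** The ranges of [1%:M - Q] and [Q] are orthogonal. Allowing two different matrices [A] and [B] is
    what lets the modes be peeled off one at a time. *)
Lemma fnorm2_projD m n (Q : 'M[R]_m) (A B : 'M[R]_(m, n)) :
  Q^T = Q -> Q *m Q = Q ->
  fnorm2 ((1%:M - Q) *m A + Q *m B) = fnorm2 ((1%:M - Q) *m A) + fnorm2 (Q *m B).
Proof.
move=> QT QQ; apply: fnorm2D.
by rewrite trmx_mul linearB /= trmx1 QT mulmxA -(mulmxA A^T) mulmxBl mul1mx QQ subrr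
  mulmx0 mul0mx.
Qed.

Lemma fnorm2_proj_split m n (Q : 'M[R]_m) (A : 'M[R]_(m, n)) :
  Q^T = Q -> Q *m Q = Q ->
  fnorm2 A = fnorm2 ((1%:M - Q) *m A) + fnorm2 (Q *m A).
Proof.
move=> QT QQ; rewrite -fnorm2_projD //.
by rewrite -mulmxDl subrK mul1mx.
Qed.

End FrobeniusNorm.

(** * L-DEIM *)

Section Interpolation.
Context {R : realType}.

(** Forward substitution: row [i] of [H] is the [i]-th unit row minus a combination of the earlier
    rows of [H] with coefficients at most 1 in absolute value. By induction its 1-norm is at most 1
    + (1 + 2 + ... + 2^(i-1)) = 2^i. *)
Lemma unit_lower_inv_rowsum k (L H : 'M[R]_k) :
  (forall i j : 'I_k, (i < j)%N -> L i j = 0) -> (forall i, L i i = 1) ->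
  (forall i j, `|L i j| <= 1) -> L *m H = 1%:M ->
  forall i, \sum_j `|H i j| <= 2 ^+ i.
Proof.
move=> L0 L1 Lle LH i; have [n] := ubnP (val i); elim: n i => // n IHn i ltin.
have Hi j : `|H i j| <= (i == j)%:R + \sum_(l < k | (l < i)%N) `|H l j|.
  have /matrixP/(_ i j) := LH; rewrite !mxE (bigD1 i) //= L1 mul1r.
  move/(canRL (addrK _)) => ->.
  rewrite (le_trans (ler_normB _ _)) // normr_nat lerD2l.
  rewrite (bigID (fun l : 'I_k => (l < i)%N)) /=.
  rewrite [X in _ + X]big1 ?addr0; last first.
    move=> l /andP[li]; rewrite -leqNgt leq_eqVlt => /orP[/eqP/val_inj eil|il].
      by rewrite eil eqxx in li.
    by rewrite L0 // mul0r.
  rewrite (le_trans (ler_norm_sum _ _ _)) //.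
  rewrite [leLHS](eq_bigl (fun l : 'I_k => (l < i)%N)); last first.
    by move=> l; case: (l =P i) => [->|]; rewrite ?ltnn /=.
  by apply: ler_sum => l _; rewrite normrM ler_piMl.
apply: (le_trans (ler_sum _ (fun j _ => Hi j))).
rewrite big_split /= (bigD1 i) //= eqxx big1 ?addr0; last first.
  by move=> j; rewrite eq_sym => /negPf->.
rewrite exchange_big /=.
apply: (@le_trans _ _ (1 + \sum_(l < k | (l < i)%N) 2 ^+ l)).
  rewrite lerD2l; apply: ler_sum => l li; apply: IHn.
  by rewrite (leq_trans li) // -ltnS.
rewrite -(big_ord_widen _ (fun l => 2 ^+ l)); last exact: ltnW.
by have := subrX1 (2 : R) i => /(canRL (subrK _)) ->; rewrite mulrBl mul1r; lra.
Qed.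

(** The 2-norm of a row is at most its 1-norm, so the geometric sum of the [4 ^+ i] bounds the left
    side; it equals (4^k - 1)/3, whence the 3 in the final bound. *)
Lemma unit_lower_inv_fnorm2 k (L H : 'M[R]_k) :
  (forall i j : 'I_k, (i < j)%N -> L i j = 0) -> (forall i, L i i = 1) ->
  (forall i j, `|L i j| <= 1) -> L *m H = 1%:M ->
  fnorm2 H <= 4 ^+ k / 3.
Proof.
move=> L0 L1 Lle LH.
apply: (@le_trans _ _ (\sum_(i < k) 4 ^+ i)).
  apply: ler_sum => i _.
  apply: (@le_trans _ _ ((\sum_j `|H i j|) ^+ 2)); last first.
    have -> : (4 : R) ^+ i = (2 ^+ i) ^+ 2 by rewrite exprAC; congr (_ ^+ _); ring.
    rewrite lerXn2r ?nnegrE ?exprn_ge0 ?sumr_ge0 //.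
    exact: (unit_lower_inv_rowsum L0 L1 Lle LH).
  rewrite [leRHS]expr2 mulr_suml; apply: ler_sum => j _.
  rewrite -real_normK ?num_real // expr2 ler_wpM2l //.
  by rewrite (bigD1 j) //= lerDl sumr_ge0.
by have := subrX1 (4 : R) k; lra.
Qed.

(** * The columns produced by the L-DEIM loop *)

Section State.
Variables (N kh k : nat) (kh_le_k : (kh <= k)%N) (s : 'I_k -> 'I_N).
Variable W : 'M[R]_(N, kh).
Let p (j : 'I_kh) := s (widen_ord kh_le_k j).
Let Z := deim_state kh_le_k s W kh.

Lemma deim_stateS_col t i (l : 'I_kh) : l <> t.+1 :> nat ->
  deim_state kh_le_k s W t.+1 i l = deim_state kh_le_k s W t i l.
Proof.
move=> lt /=; case: insubP => [j _ jt|//]; rewrite mxE; case: eqP => // lj.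
by case: lt; rewrite lj.
Qed.

Lemma deim_state_final t i (l : 'I_kh) : (l <= t)%N ->
  deim_state kh_le_k s W t i l = deim_state kh_le_k s W l i l.
Proof.
elim: t => [|t IHt]; first by rewrite leqn0 => /eqP ->.
rewrite leq_eqVlt => /predU1P[->//|lt].
rewrite deim_stateS_col ?IHt //; by move=> e; rewrite e ltnn in lt.
Qed.

Lemma deim_state_untouched t i (l : 'I_kh) : (t < l)%N ->
  deim_state kh_le_k s W t i l = W i l.
Proof.
elim: t => [//|t IHt] tl.
by rewrite deim_stateS_col ?IHt // ?(ltnW tl)// => e; rewrite e ltnn in tl.
Qed.

(** The first claim only records the shape of the column operation and holds whatever [invmx]
    returns. The second needs the interpolation matrix to be invertible, which its triangular shape
    with nonzero diagonal ensures; these premises are discharged later by induction on [j]. *)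
Lemma deim_final_colE (j : 'I_kh) : exists c : 'I_kh -> R,
  (forall i, Z i j = W i j - \sum_(l < kh | (l < j)%N) Z i l * c l) /\
  ((forall a b : 'I_kh, (a < b)%N -> (b < j)%N -> Z (p a) b = 0) ->
   (forall a : 'I_kh, (a < j)%N -> Z (p a) a != 0) ->
   forall a : 'I_kh, (a < j)%N -> Z (p a) j = 0).
Proof.
have ZE i : Z i j = deim_state kh_le_k s W j i j.
  by rewrite /Z deim_state_final // ltnW.
(* Pass [j] works on the state after [j.-1] passes, where all columns before [j] are already
   final. *)
have ZEl i (l : 'I_kh) (lj : (l < j)%N) : Z i l = deim_state kh_le_k s W j.-1 i l.
  rewrite /Z deim_state_final; last exact: ltnW.
  by rewrite [RHS]deim_state_final // -ltnS (leq_trans lj) // leqSpred.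
have [j0|j_gt0] := posnP j.
  exists (fun=> 0); split=> [i|_ _ a]; last by rewrite j0.
  by rewrite big1 => [|l _]; rewrite ?mulr0 // subr0 ZE j0.
have jS : (val j).-1.+1 = j := prednK j_gt0.
set W' := deim_state kh_le_k s W j.-1 in ZEl.
set j_le := ltnW (ltn_ord j).
pose sj (i : 'I_j) := s (widen_ord (leq_trans j_le kh_le_k) i).
pose M := rowsub sj (colsub (widen_ord j_le) W').
pose c := invmx M *m rowsub sj (col j W').
have over i : Z i j = (col j W' - colsub (widen_ord j_le) W' *m c) i 0.
  rewrite ZE -{1}jS /= insubT ?jS // => jk.
  have -> : Sub (val j) jk = j by apply: val_inj.
  by rewrite /deim_overwrite mxE eqxx.
have W'j i : W' i j = W i j by apply: deim_state_untouched; rewrite prednK.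
exists (fun l => if insub (val l) is Some l' then c l' 0 else 0); split.
  move=> i; rewrite over !mxE W'j; congr (_ - _).
  rewrite (big_ord_narrow j_le); apply: eq_bigr => l _; rewrite mxE.
  rewrite insubT //= => lj; rewrite ZEl //; congr (_ * c _ _).
  exact: val_inj.
move=> tri diag a aj.
have Munit : M \in unitmx.
  have Mtrig : is_trig_mx M.
    apply/is_trig_mxP => b b' lt; rewrite !mxE -ZEl; last exact: (ltn_ord b').
    rewrite -[RHS](tri (widen_ord j_le b) (widen_ord j_le b')) /=; last 2 first.
    - exact: lt.
    - exact: (ltn_ord b').
    by congr (Z (s _) _); apply: val_inj.
  rewrite unitmxE unitfE det_trig // prodf_seq_neq0; apply/allP => b _ /=.
  rewrite !mxE -ZEl /=; last exact: (ltn_ord b).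
  have := diag (widen_ord j_le b) (ltn_ord b).
  apply: contraNN => /eqP e; apply/eqP; rewrite -[RHS]e.
  by congr (Z (s _) _); apply: val_inj.
(* On the selected rows the correction is [M *m (invmx M *m _)], which reproduces the old column
   exactly. *)
have : rowsub sj (col j W' - colsub (widen_ord j_le) W' *m c) = 0.
  have -> : forall B D : 'cV[R]_N, rowsub sj (B - D) = rowsub sj B - rowsub sj D.
    by move=> B D; apply/matrixP => x y; rewrite !mxE.
  have -> : rowsub sj (colsub (widen_ord j_le) W' *m c) = M *m c.
    apply/matrixP => x y; rewrite !mxE; apply: eq_bigr => z _; by rewrite !mxE.
  by rewrite /c mulmxA mulmxV // mul1mx subrr.
move/matrixP/(_ (Ordinal aj) 0); rewrite !mxE => <-.
rewrite over !mxE /p /sj.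
have -> : widen_ord kh_le_k a = widen_ord (leq_trans j_le kh_le_k) (Ordinal aj).
  exact: val_inj.
by [].
Qed.

End State.

(** Quantitative invertibility of the selected rows of [W]: column normalization of the loop's
    output yields an LU-type factorization whose triangular factor has bounded entries. *)
Lemma ldeim_interpolation N kh k (kh_le_k : (kh <= k)%N) (s : 'I_k -> 'I_N)
    (W : 'M[R]_(N, kh)) :
  W^T *m W = 1%:M -> ldeim kh_le_k s W ->
  exists2 B : 'M[R]_kh, rowsub (fun j => s (widen_ord kh_le_k j)) W *m B = 1%:M
    & fnorm2 B <= N%:R * kh%:R * (4 ^+ kh / 3).
Proof.
move=> WW [smax _ _].
set p := fun j => s (widen_ord kh_le_k j).
pose Z := deim_state kh_le_k s W kh.
have Zmax i j : `|Z i j| <= `|Z (p j) j|.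
  by rewrite /Z !deim_state_final ?smax // ltnW.
(* Carried together by strong induction: column [j] stays in the range of [W], [W^T *m Z] is unit
   upper triangular, column [j] vanishes at the earlier selected rows, and its pivot is nonzero. The
   last two facts for earlier columns are the premises of [deim_final_colE]. *)
have inv (j : 'I_kh) : [/\ W *m (W^T *m col j Z) = col j Z,
    forall i : 'I_kh, (j <= i)%N -> (W^T *m Z) i j = (i == j)%:R,
    forall a : 'I_kh, (a < j)%N -> Z (p a) j = 0
    & Z (p j) j != 0].
  have [n] := ubnP (val j); elim: n j => // n IHn j ltjn.
  have IH (l : 'I_kh) (lj : (l < j)%N) := IHn l (leq_trans lj ltjn).
  have [c [ZE Z0]] := deim_final_colE kh_le_k s W j.
  have colZ : col j Z = col j W - \sum_(l < kh | (l < j)%N) c l *: col l Z.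
    apply/matrixP => x y; rewrite !mxE summxE [LHS]ZE; congr (_ - _).
    by apply: eq_bigr => l _; rewrite !mxE mulrC.
  have WZ (i : 'I_kh) : (j <= i)%N -> (W^T *m Z) i j = (i == j)%:R.
    move=> ji; have -> : (W^T *m Z) i j = (W^T *m col j Z) i 0.
      by rewrite !mxE; apply: eq_bigr => x _; rewrite !mxE.
    rewrite colZ mulmxBr mxE [X in _ + X]mxE mulmx_sumr summxE big1 => [|l lj].
      have -> : (W^T *m col j W) i 0 = (W^T *m W) i j.
        by rewrite !mxE; apply: eq_bigr => x _; rewrite !mxE.
      by rewrite WW mxE subr0.
    have [_ WZl _ _] := IH l lj.
    rewrite -scalemxAr mxE.
    have -> : (W^T *m col l Z) i 0 = (W^T *m Z) i l.
      by rewrite !mxE; apply: eq_bigr => x _; rewrite !mxE.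
    rewrite WZl; last exact: leq_trans (ltnW lj) ji.
    by case: eqP lj => [<-|]; rewrite ?mulr0 // ltnNge ji.
  split=> //.
  - rewrite colZ mulmxBr mulmxBr; congr (_ - _).
      by rewrite colE (mulmxA W^T) WW mul1mx.
    rewrite !mulmx_sumr; apply: eq_bigr => l lj; rewrite -!scalemxAr.
    by have [-> _ _ _] := IH l lj.
  - apply: Z0 => [a b ab bj|a aj]; first by have [_ _ + _] := IH b bj; apply.
    by have [_ _ _] := IH a aj.
  (* The pivot is the largest entry of its column, so a zero pivot means a zero column, against the
     unit diagonal of [W^T *m Z]. *)
  - apply/eqP => Zj0; have colj0 : col j Z = 0.
      apply/matrixP => x y; rewrite !mxE; apply/eqP; rewrite -normr_le0.
      by rewrite (le_trans (Zmax x j)) // Zj0 normr0.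
    have := WZ j (leqnn _); rewrite eqxx.
    have -> : (W^T *m Z) j j = (W^T *m col j Z) j 0.
      by rewrite !mxE; apply: eq_bigr => x _; rewrite !mxE.
    by rewrite colj0 mulmx0 mxE => /esym/eqP; rewrite oner_eq0.
pose Y := Z *m diag_mx (\row_j (Z (p j) j)^-1).
have YE i j : Y i j = Z i j / Z (p j) j by rewrite /Y mul_mx_diag !mxE.
have Yle i j : `|Y i j| <= 1.
  have [_ _ _ nz] := inv j.
  by rewrite YE normrM normfV ler_pdivrMr ?normr_gt0 // mul1r.
have WWZ : W *m (W^T *m Z) = Z.
  apply/matrixP => i j; have [/matrixP/(_ i 0) + _ _ _] := inv j.
  rewrite [RHS]mxE => <-; rewrite !mxE; apply: eq_bigr => m _; congr (_ * _).
  by rewrite !mxE; apply: eq_bigr => x _; rewrite !mxE.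
have WWY : W *m (W^T *m Y) = Y by rewrite /Y (mulmxA W^T) (mulmxA W) WWZ.
pose L := rowsub p Y.
have Lunit : L \in unitmx.
  have Ltrig : is_trig_mx L.
    apply/is_trig_mxP => a b ab; rewrite mxE YE.
    by have [_ _ /(_ a ab) -> _] := inv b; rewrite mul0r.
  rewrite unitmxE unitfE det_trig // prodf_seq_neq0; apply/allP => b _ /=.
  by have [_ _ _ nz] := inv b; rewrite mxE YE divff ?oner_neq0.
(* Since [W *m (W^T *m Y) = Y], the selected rows of [W] times [W^T *m Y] give [L]. The same
   identity makes [W^T *m Y] as large as [Y], whose [N * kh] entries are at most 1 in absolute
   value. *)
exists (W^T *m Y *m invmx L).
  by rewrite mulmxA mul_rowsub_mx WWY mulmxV.
rewrite (le_trans (fnorm2M _ _)) // ler_pM ?fnorm2_ge0 //.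
  have -> : fnorm2 (W^T *m Y) = fnorm2 Y.
    by rewrite -(fnorm2_isometry (W^T *m Y) WW) WWY.
  apply: (@le_trans _ _ (\sum_(i < N) \sum_(j < kh) 1)).
    apply: ler_sum => i _; apply: ler_sum => j _.
    by rewrite -real_normK ?num_real // expr_le1.
  by rewrite !sumr_const !card_ord -mulrnA mulrC -natrM mulnC.
apply: (@unit_lower_inv_fnorm2 _ L).
- move=> a b ab; rewrite mxE YE.
  by have [_ _ /(_ a ab) -> _] := inv b; rewrite mul0r.
- by move=> a; rewrite mxE YE; have [_ _ _ nz] := inv a; rewrite divff.
- by move=> a b; rewrite mxE.
- exact: mulmxV.
Qed.

End Interpolation.

(** * Singular values and column selection *)

Section SingularValues.
Context {R : realType}.

Lemma char_poly_conj_orthogonal n (U D : 'M[R]_n) :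
  U^T *m U = 1%:M -> char_poly (U *m D *m U^T) = char_poly D.
Proof.
move=> UU; have UUV : U *m U^T = 1%:M := mulmx1C UU.
rewrite /char_poly /char_poly_mx !map_mxM /=.
set u := map_mx _ U; set v := map_mx _ U^T.
have uv : u *m v = 1%:M by rewrite -map_mxM UUV map_mx1.
have {1}-> : 'X%:M = u *m 'X%:M *m v.
  by rewrite mul_mx_scalar -scalemxAl uv scalemx1.
by rewrite -mulmxBl -mulmxBr !det_mulmx mulrAC -det_mulmx uv det1 mul1r.
Qed.

(** [A *m A^T] is orthogonally similar to the diagonal matrix of the squares [s i ^+ 2], where
    indices from [n] on contribute zeros. *)
Lemma singular_values_char_poly m n (A : 'M[R]_(m, n)) s :
  singular_values A s ->
  char_poly (A *m A^T) = \prod_(x <- [seq s i ^+ 2 | i <- iota 0 m]) ('X - x%:P).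
Proof.
move=> [U [V [UU VV _ s0 ->]]].
set S := \matrix_(i, j) _.
have -> : U *m S *m V^T *m (U *m S *m V^T)^T = U *m (S *m S^T) *m U^T.
  by rewrite !trmx_mul trmxK !mulmxA -(mulmxA _ V^T) VV mulmx1.
have SS : S *m S^T = diag_mx (\row_(i < m) s i ^+ 2).
  apply/matrixP => i i'; rewrite !mxE.
  under eq_bigr => j _ do rewrite !mxE.
  have [nlei|ltin] := leqP n i.
    rewrite s0 ?(leq_trans (geq_minr _ _)) // expr0n mul0rn big1 // => j _.
    by rewrite mul0rn mul0r.
  rewrite (bigD1 (Ordinal ltin)) //= eqxx mulr1n big1 ?addr0 => [|j ji].
    have [->|ne] := eqVneq i i'; first by rewrite eqxx mulr1n expr2.
    by rewrite val_eqE eq_sym (negPf ne) mulr0.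
  case: eqP => [ij|]; last by rewrite mul0r.
  by case/eqP: ji; apply: val_inj.
rewrite char_poly_conj_orthogonal // SS char_poly_trig; last first.
  by apply: diag_mx_is_trig.
rewrite -val_enum_ord big_map big_map big_enum /=.
by apply: eq_bigr => i _; rewrite !mxE eqxx.
Qed.

(** Both lists of squares are the roots of one characteristic polynomial, in decreasing order;
    nonnegativity removes the squares. This allows [sigma] to come from another decomposition than
    the singular vectors that the algorithm used. *)
Lemma singular_values_inj m n (A : 'M[R]_(m, n)) s t :
  singular_values A s -> singular_values A t -> s =1 t.
Proof.
move=> ss ts i; have := singular_values_char_poly ss.
rewrite (singular_values_char_poly ts) => /prod_XsubC_eq.
have sq x (xs : singular_values A x) : sorted >=%O [seq x i ^+ 2 | i <- iota 0 m].
  case: xs => [U [V [_ _ [x0 xle] _ _]]].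
  rewrite sorted_map; apply: (@sub_sorted _ leq); last exact: iota_sorted.
  move=> a b ab /=; by rewrite lerXn2r ?nnegrE // xle.
move/(sorted_eq ge_trans ge_anti (sq _ ts) (sq _ ss)).
case: ss => [U [V [_ _ [s0 _] sm _]]]; case: ts => [U' [V' [_ _ [t0 _] tm _]]].
have [mi _|im] := leqP m i.
  by rewrite sm ?tm // (leq_trans (geq_minl _ _)).
move/(congr1 (fun l => nth 0 l i)).
rewrite !(nth_map 0%N) ?size_iota // nth_iota //.
by rewrite add0n => /eqP; rewrite eqrXn2 // => /eqP.
Qed.

Lemma sum_ord_eq_le n (i : nat) (c : R) :
  0 <= c -> \sum_(l < n | i == l) c <= c.
Proof.
move=> c0; rewrite sumr_const -[leRHS]mulr1n ler_wpMn2l //.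
apply/card_le1_eqP => a b /eqP ia /eqP ib.
by apply: val_inj; rewrite /= -ia -ib.
Qed.

(** The diagonal factor enters through a bound on its spectral norm rather than its Frobenius norm:
    it rescales the rows of [B], dropping some or adding zero rows when [m] and [n] differ. *)
Lemma diag_mulmx_fnorm2 m n p (d : 'I_m -> R) (c : R) (B : 'M[R]_(n, p)) :
  (forall i, `|d i| <= c) ->
  fnorm2 (\matrix_(i < m, j < n) (d i *+ (i == j :> nat)) *m B)
    <= c ^+ 2 * fnorm2 B.
Proof.
move=> dc; rewrite /fnorm2; set D := \matrix_(i, j) _.
have Bl_ge0 l : 0 <= c ^+ 2 * \sum_j B l j ^+ 2.
  by rewrite mulr_ge0 ?sqr_ge0 // sumr_ge0 // => j _; exact: sqr_ge0.
have row (i : 'I_m) : \sum_j (D *m B) i j ^+ 2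
   <= \sum_(l < n | i == l :> nat) c ^+ 2 * \sum_j B l j ^+ 2.
  have [nlei|ltin] := leqP n i.
    rewrite big1 => [|j _]; first exact: sumr_ge0.
    rewrite mxE big1 ?expr0n // => l _; rewrite mxE.
    case: eqP => [il|]; last by rewrite mul0r.
    by have := ltn_ord l; rewrite -il ltnNge nlei.
  rewrite (big_pred1 (Ordinal ltin)) => [|l]; last first.
    by rewrite /=; apply/eqP/eqP => [il|-> //]; apply: val_inj.
  rewrite mulr_sumr; apply: ler_sum => j _.
  rewrite mxE (bigD1 (Ordinal ltin)) //= mxE eqxx mulr1n big1 ?addr0 => [|l li].
    rewrite exprMn ler_wpM2r ?sqr_ge0 // -real_normK ?num_real //.
    by rewrite lerXn2r ?nnegrE // (le_trans (normr_ge0 _) (dc i)).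
  rewrite mxE; case: eqP => [il|]; last by rewrite mul0r.
  by case/eqP: li; apply: val_inj.
apply: (le_trans (ler_sum _ (fun i _ => row i))).
rewrite (exchange_big_dep xpredT) //= mulr_sumr; apply: ler_sum => l _.
under eq_bigl => i do rewrite eq_sym.
exact: sum_ord_eq_le.
Qed.

End SingularValues.

(** * Projection error of the selected columns of one matrix *)

Section ColumnSelection.
Context {R : realType}.

Lemma ldeim_column_error m n kh k (kh_le_k : (kh <= k)%N) (A : 'M[R]_(m, n))
    (s : 'I_k -> 'I_n) (W : 'M[R]_(n, kh)) (P : 'M[R]_(k, m)) (sigma : nat -> R) :
  (0 < kh <= m)%N -> leading_right_singular_vectors A W ->
  ldeim kh_le_k s W -> is_moore_penrose (colsub s A) P -> singular_values A sigma ->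
  fnorm2 ((1%:M - colsub s A *m P) *m A)
    <= m%:R * n%:R * (4 ^+ kh * kh%:R / 3) * sigma kh ^+ 2.
Proof.
move=> /andP[kh0 khm] [U [sg [V [khn [svd WE]]]]] sW.
rewrite /is_moore_penrose; set C := colsub s A => -[CPC _ CPT _] sv.
have {sv} <- : sg kh = sigma kh.
  by apply: (@singular_values_inj _ _ _ A) => //; exists U, V.
case: svd => [UU VV [sg0 sgle] sgm AE].
set S := \matrix_(i, j) _ in AE.
have VVT := mulmx1C VV.
pose J : 'M[R]_(n, kh) := colsub (widen_ord khn) 1%:M.
have WJ : W = V *m J by rewrite WE /J mulmx_colsub mulmx1.
have JJ : J^T *m J = 1%:M.
  apply/matrixP => a b; rewrite !mxE (bigD1 (widen_ord khn a)) //= !mxE eqxx mul1r.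
  rewrite big1 ?addr0 => [|l la]; last by rewrite !mxE (negPf la) mul0r.
  by rewrite -val_eqE.
have WW : W^T *m W = 1%:M by rewrite WJ trmx_mul -mulmxA (mulmxA V^T) VV mul1mx.
have [B WB Bn] := ldeim_interpolation WW sW.
set p := fun j => s _ in WB.
pose Sp : 'M[R]_(n, kh) := colsub p 1%:M.
have SpW : rowsub p W = Sp^T *m W.
  by rewrite /Sp trmx_mxsub trmx1 mul_rowsub_mx mul1mx.
(* A repeated selected row would give two equal rows of the identity matrix [rowsub p W *m B]. *)
have pinj : injective p.
  move=> a b pab; have /matrixP/(_ a a) := WB; have /matrixP/(_ b a) := WB.
  rewrite !mxE eqxx; under eq_bigr => l _ do rewrite mxE -pab.
  under [in X in _ -> X]eq_bigr => l _ do rewrite mxE.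
  by move=> ->; case: (b =P a) => [->//|_] /eqP; rewrite eq_sym oner_eq0.
have SpSp : Sp^T *m Sp = 1%:M.
  apply/matrixP => a b; rewrite !mxE (bigD1 (p a)) //= !mxE eqxx mul1r.
  rewrite big1 ?addr0 => [|l la]; last by rewrite !mxE (negPf la) mul0r.
  by rewrite (inj_eq pinj).
pose E : 'M[R]_(m, n) := A - A *m W *m W^T.
have EW : E *m W = 0 by rewrite mulmxBl -(mulmxA (A *m W)) WW mulmx1 subrr.
pose d (i : 'I_m) := if (i < kh)%N then 0 else sg i.
pose D : 'M[R]_(m, n) := \matrix_(i, j) (d i *+ (i == j :> nat)).
(* Removing the [kh] leading right singular directions zeroes the first [kh] singular values, so
   [sg kh] bounds those that remain. *)
have EE : E = U *m (D *m V^T).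
  have SJ : S - S *m J *m J^T = D.
    have -> : S *m J *m J^T = S *m diag_mx (\row_j (j < kh)%:R).
      rewrite -mulmxA; congr (_ *m _); apply/matrixP => a b; rewrite !mxE.
      have [akh|kha] := ltnP a kh.
        rewrite (bigD1 (Ordinal akh)) //= !mxE big1 ?addr0 => [|l la].
          rewrite -!val_eqE /= eqxx mul1r eq_sym.
          by case: (val b == a) / eqP => [ba|_]; rewrite ?ba ?akh.
        rewrite !mxE -val_eqE /=; case: eqP => [al|_]; last by rewrite mul0r.
        by case/eqP: la; apply: val_inj.
      rewrite big1 => [|l _]; first by rewrite mul0rn.
      rewrite !mxE -val_eqE /=; case: eqP => [al|_]; last by rewrite mul0r.
      by have := ltn_ord l; rewrite -al ltnNge kha.
    apply/matrixP => i j; rewrite mul_mx_diag !mxE /d.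
    have [->|_] := eqVneq (val i) j; last by rewrite !mulr0n mul0r subr0.
    by case: ltnP => _; rewrite ?mulr1 ?mulr0 ?subrr ?subr0.
  rewrite /E AE WJ trmx_mul -!mulmxA (mulmxA V^T V) VV mul1mx -mulmxBr.
  congr (_ *m _).
  by rewrite -SJ mulmxBl !mulmxA.
(* The difference [A - E] is a multiple of [W^T], and [W^T *m Sp *m B^T = 1%:M] says that the
   oblique projection reproduces it exactly. *)
have err : A - A *m Sp *m B^T *m W^T = E - E *m Sp *m B^T *m W^T.
  have WSB : W^T *m Sp *m B^T = 1%:M.
    by have := congr1 trmx (mulmx1C WB); rewrite SpW !trmx_mul trmxK trmx1.
  rewrite /E !mulmxBl -(mulmxA (A *m W) W^T Sp) -(mulmxA (A *m W) (W^T *m Sp)).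
  by rewrite WSB mulmx1 opprB addrA subrK.
(* The rows of [E] are orthogonal to the columns of [W]; transposing brings this to the form of
   [fnorm2D]. *)
have errn (M : 'M_(m, kh)) : fnorm2 (E - M *m W^T) = fnorm2 E + fnorm2 M.
  rewrite -fnorm2_tr [(_ - _)^T]linearB /= trmx_mul trmxK fnorm2D.
    by rewrite fnorm2N fnorm2_isometry // !fnorm2_tr.
  by rewrite trmxK mulmxN mulmxA EW mul0mx oppr0.
have CA : (1%:M - C *m P) *m (A *m Sp) = 0.
  have -> : A *m Sp = C *m colsub (widen_ord kh_le_k) 1%:M.
    by rewrite !mulmx_colsub !mulmx1 /C -colsub_comp.
  by rewrite mulmxA mulmxBl mul1mx CPC subrr mul0mx.
have -> : (1%:M - C *m P) *m A = (1%:M - C *m P) *m (E - E *m Sp *m B^T *m W^T).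
  by rewrite -err mulmxBr !mulmxA -(mulmxA _ A) CA !mul0mx subr0.
apply: (@le_trans _ _ (fnorm2 (E - E *m Sp *m B^T *m W^T))).
  rewrite [leRHS](fnorm2_proj_split (Q := C *m P)) // ?mulmxA ?CPC //.
  by rewrite lerDl fnorm2_ge0.
have d_le i : `|d i| <= sg kh.
  rewrite /d; case: ltnP => [_|khi]; first by rewrite normr0.
  by rewrite ger0_norm // sgle.
have m_gt0 : (0 < m)%N := leq_trans kh0 khm.
(* Row 0 of [D] vanishes because [kh] is positive. The row saved here is what lets this term fit
   under the product bound at the end. *)
have En : fnorm2 E <= (m%:R - 1) * sg kh ^+ 2.
  rewrite EE fnorm2_isometry // -fnorm2_tr trmx_mul trmxK.
  rewrite fnorm2_isometry // fnorm2_tr.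
  have rowD (i : 'I_m) : \sum_j D i j ^+ 2 <= d i ^+ 2.
    apply: le_trans (sum_ord_eq_le n i (sqr_ge0 (d i))).
    rewrite [leRHS]big_mkcond; apply: ler_sum => j _; rewrite mxE.
    by case: eqP => _; rewrite ?mulr1n ?mulr0n ?expr0n.
  apply: (le_trans (ler_sum _ (fun i _ => rowD i))).
  rewrite (bigD1 (Ordinal m_gt0)) //= {1}/d /= kh0 expr0n add0r.
  apply: (@le_trans _ _ (\sum_(i < m | i != Ordinal m_gt0) sg kh ^+ 2)).
    apply: ler_sum => i _; rewrite -real_normK ?num_real //.
    by rewrite lerXn2r ?nnegrE.
  rewrite sumr_const (cardC1 (Ordinal m_gt0)) card_ord -[leLHS]mulr_natl.
  by have := natr1 (R := R) m.-1; rewrite prednK // => <-; rewrite addrK.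
have EBn : fnorm2 (E *m Sp *m B^T) <= sg kh ^+ 2 * fnorm2 B.
  rewrite EE -!mulmxA fnorm2_isometry //.
  apply: (le_trans (diag_mulmx_fnorm2 _ d_le)).
  by rewrite fnorm2_isometry ?trmxK // fnorm2_isometry // fnorm2_tr.
have b_ge1 : 1 <= n%:R * kh%:R * (4 ^+ kh / 3) :> R.
  have n1 : 1 <= n%:R :> R by rewrite ler1n (leq_trans kh0).
  have k1 : 1 <= kh%:R :> R by rewrite ler1n.
  have e1 : 1 <= 4 ^+ kh / 3 :> R.
    rewrite -(prednK kh0) exprS.
    have : 1 <= 4 ^+ kh.-1 :> R by rewrite exprn_ege1 // ler1n.
    by lra.
  by apply: mulr_ege1 e1; apply: mulr_ege1.
rewrite errn; apply: (le_trans (lerD En EBn)).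
have m1 : 1 <= m%:R :> R by rewrite ler1n.
have s2 := sqr_ge0 (sg kh).
set b := n%:R * kh%:R * (4 ^+ kh / 3) in Bn b_ge1.
have -> : m%:R * n%:R * (4 ^+ kh * kh%:R / 3) * sg kh ^+ 2 = m%:R * b * sg kh ^+ 2.
  by rewrite /b; ring.
apply: (@le_trans _ _ ((m%:R - 1) * sg kh ^+ 2 + sg kh ^+ 2 * b)).
  by rewrite lerD2l ler_wpM2l.
(* The slack of (m - 1) + b <= m b is (m - 1)(b - 1), nonnegative since both [m] and [b] are at
   least 1. *)
rewrite -subr_ge0.
have -> : m%:R * b * sg kh ^+ 2 - ((m%:R - 1) * sg kh ^+ 2 + sg kh ^+ 2 * b)
    = (m%:R - 1) * (b - 1) * sg kh ^+ 2 by ring.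
by rewrite !mulr_ge0 // subr_ge0.
Qed.

End ColumnSelection.

(** * Tensors *)

Section TensorProducts.
Context {R : realType}.

(** Distributivity when the range of summation varies with the factor. The sums are moved to the
    tagged union of the [T_ t], where ordinary distributivity applies, and [untag 0] extends each
    factor by 0. *)
Lemma prod_sum_dffun (T : finType) (T_ : T -> finType) (F : forall t, T_ t -> R) :
  \prod_t \sum_(c : T_ t) F t c =
  \sum_(f : {dffun forall t, T_ t}) \prod_t F t (f t).
Proof.
pose P t := [ffun c => F t c].
rewrite (reindex (@dffun_of_fprod T T_)) /=; last first.
  by apply: onW_bij; exact: dffun_of_fprod_bij.
transitivity (\sum_(g : fprod T_) \prod_(t in T) P t (g t)).
  rewrite big_fprod.
  rewrite -(bigA_distr_big_dep (tagged_with T_) (fun t => untag 0 (P t))).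
  apply: eq_bigr => t _.
  by rewrite -(big_tag (fun t => P t)); apply: eq_bigr => c _; rewrite ffunE.
by apply: eq_bigr => g _; apply: eq_bigr => t _; rewrite !ffunE.
Qed.

(** Extension by 0 outside the bounds, which makes the entries insensitive to [castmx]. *)
Definition nat_entry m n (A : 'M[R]_(m, n)) (a b : nat) : R :=
  if (insub a, insub b) is (Some i, Some j) then A i j else 0.

Lemma nat_entryE m n (A : 'M[R]_(m, n)) (i : 'I_m) (j : 'I_n) :
  nat_entry A i j = A i j.
Proof. by rewrite /nat_entry !valK. Qed.

Lemma nat_entry_castmx m n m' n' (e : (m = m') * (n = n')) (A : 'M[R]_(m, n)) :
  nat_entry (castmx e A) = nat_entry A.
Proof. by case: e => e1 e2; case: _ / e1; case: _ / e2. Qed.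

Definition nat_delta (a b : nat) : R := (a == b)%:R.

Variable d : nat.
Implicit Types (I J K : 'I_d -> nat) (n : 'I_d) (f g : 'I_d -> nat -> nat -> R).

(* Kernels take indices in nat, so that the dimension casts of [multi_prod]
   disappear. *)
Definition kernel_prod I J f (X : tensor R I) : tensor R J :=
  [ffun j : midx J => \sum_(i : midx I) X i * \prod_n f n (j n) (i n)].

Lemma eq_kernel_prod I J f g (X : tensor R I) :
  (forall n (a : 'I_(J n)) (b : 'I_(I n)), f n a b = g n a b) ->
  kernel_prod J f X = kernel_prod J g X.
Proof.
move=> fg; apply/ffunP => j; rewrite !ffunE; apply: eq_bigr => i _.
by congr (_ * _); apply: eq_bigr => n _.
Qed.

(** After exchanging the sums, the sum over intermediate multi-indices factors over the modes by
    [prod_sum_dffun]. *)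
Lemma kernel_prod_comp I K J f g (X : tensor R I) :
  kernel_prod J f (kernel_prod K g X) =
  kernel_prod J (fun n a b => \sum_(c < K n) f n a c * g n c b) X.
Proof.
apply/ffunP => j; rewrite !ffunE.
under eq_bigr => k _ do rewrite ffunE mulr_suml.
rewrite exchange_big; apply: eq_bigr => i _ /=.
rewrite (prod_sum_dffun (fun n (c : 'I_(K n)) => f n (j n) c * g n c (i n))).
rewrite mulr_sumr; apply: eq_bigr => k _.
by rewrite -mulrA -big_split; congr (_ * _); apply: eq_bigr => n _; rewrite mulrC.
Qed.

Lemma kernel_prod_delta I J (eIJ : I =1 J) (X : tensor R I) :
  kernel_prod J (fun=> nat_delta) X = tensor_cast eIJ X.
Proof.
apply/ffunP => j; rewrite !ffunE.
set i0 : midx I := [ffun m => _].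
rewrite (bigD1 i0) //= big1 => [|n _]; last by rewrite ffunE /nat_delta eqxx.
rewrite mulr1 big1 ?addr0 // => i ii0.
have [n ne] : exists n, i n != i0 n.
  by apply/existsP; rewrite -negb_forall; apply: contraNN ii0 => /eqfunP/ffunP ->.
rewrite (bigD1 n) //= /nat_delta; case: eqP => [e|]; last by rewrite mul0r mulr0.
by case/eqP: ne; apply: val_inj; rewrite ffunE.
Qed.

Lemma kernel_prod_id I (X : tensor R I) : kernel_prod I (fun=> nat_delta) X = X.
Proof.
rewrite (kernel_prod_delta (fun=> erefl)); apply/ffunP => j; rewrite ffunE.
by congr (X _); apply/ffunP => n; rewrite ffunE cast_ord_id.
Qed.

Lemma kernel_prodB I J f (X Y : tensor R I) :
  kernel_prod J f (X - Y) = kernel_prod J f X - kernel_prod J f Y.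
Proof.
apply/ffunP => j; rewrite !ffunE -sumrB; apply: eq_bigr => i _.
by rewrite !ffunE mulrBl.
Qed.

Lemma mode_join_at I n (a : 'I_(I n)) (j : cidx I n) : mode_join a j n = a.
Proof.
apply: val_inj; rewrite ffunE; case: eq_comparable => [e|//].
by rewrite (eq_irrelevance e erefl).
Qed.

Lemma mode_join_off I n (a : 'I_(I n)) (j : cidx I n) (k : {k | k != n}) :
  mode_join a j (val k) = j k.
Proof.
case: k => k kn; rewrite ffunE /=; case: eq_comparable => [e|ne].
  by case/eqP: kn.
by congr (j (exist _ _ _)); apply: eq_irrelevance.
Qed.

Lemma sum_mode_join I n (F : midx I -> R) :
  \sum_i F i = \sum_(a < I n) \sum_(j : cidx I n) F (mode_join a j).
Proof.
rewrite pair_bigA /=.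
rewrite (reindex (fun p : 'I_(I n) * cidx I n => mode_join p.1 p.2)) //=.
apply: onW_bij.
exists (fun i : midx I => (i n, [ffun k => i (val k)] : cidx I n)) => [[a j]|i] /=.
  rewrite mode_join_at; congr (_, _).
  by apply/ffunP => k; rewrite ffunE mode_join_off.
apply/ffunP => k; have [->|kn] := eqVneq k n; first by rewrite mode_join_at.
by rewrite (mode_join_off _ _ (exist _ k kn)) ffunE.
Qed.

(** The deltas in the other modes kill every multi-index that disagrees with [i] outside coordinate
    [n]. *)
Lemma mode_prod_kernel I n k (X : tensor R I) (U : 'M[R]_(k, I n)) :
  mode_prod X U =
  kernel_prod _ (fun m => if m == n then nat_entry U else nat_delta) X.
Proof.
apply/ffunP => i; rewrite !ffunE (sum_mode_join n); apply: eq_bigr => a _.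
rewrite (bigD1 (mode_rest i)) //= [X in _ = _ + X]big1 ?addr0 => [|j ji].
  rewrite (bigD1 n) //= eqxx mode_join_at big1 => [|m mn].
    by rewrite mulr1 -nat_entryE.
  rewrite (negPf mn) (mode_join_off _ _ (exist _ m mn)) ffunE /=.
  by rewrite /nat_delta eqxx.
have [m ne] : exists m, j m != mode_rest i m.
  by apply/existsP; rewrite -negb_forall; apply: contraNN ji => /eqfunP/ffunP ->.
rewrite (bigD1 (val m)) //= (negPf (valP m)) mode_join_off /nat_delta.
case: eqP => [e|]; last by rewrite mul0r mulr0.
by case/eqP: ne; apply: val_inj; rewrite ffunE.
Qed.

Lemma sum_nat_deltal N a (F : 'I_N -> R) (aN : (a < N)%N) :
  \sum_(c < N) nat_delta a c * F c = F (Ordinal aN).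
Proof.
rewrite (bigD1 (Ordinal aN)) //= /nat_delta eqxx mul1r big1 ?addr0 //.
by move=> c; rewrite -val_eqE /= eq_sym => /negPf ->; rewrite mul0r.
Qed.

Lemma sum_nat_deltar N a (F : 'I_N -> R) (aN : (a < N)%N) :
  \sum_(c < N) F c * nat_delta c a = F (Ordinal aN).
Proof.
rewrite -sum_nat_deltal; apply: eq_bigr => c _.
by rewrite mulrC /nat_delta eq_sym.
Qed.

(** A pass is a cast after a mode product, hence two kernel products to compose with the previous
    kernel. In every mode all factors but one are deltas, so the inner sums collapse. *)
Lemma multi_prod_upto_kernel I J (X : tensor R I) (U : forall n, 'M[R]_(J n, I n))
    t (td : (t <= d)%N) :
  multi_prod_upto X U td =
  kernel_prod _ (fun n => if (n < t)%N then nat_entry (U n) else nat_delta) X.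
Proof.
elim: t td => [|t IHt] td /=; first by rewrite -kernel_prod_delta.
rewrite -kernel_prod_delta mode_prod_kernel IHt.
rewrite [X in kernel_prod _ _ X]kernel_prod_comp kernel_prod_comp.
set n := Ordinal td.
apply: eq_kernel_prod => m a b.
have a_lt : (a < set_dim (mixed_dim I J n) n (J n) m)%N.
  by rewrite mixed_dimS; exact: ltn_ord.
rewrite (sum_nat_deltal _ a_lt) /=.
have [mn|mn] := eqVneq m n.
  subst m; have b_lt : (b < mixed_dim I J n n)%N by rewrite mixed_dim_at.
  by rewrite ltnn ltnSn nat_entry_castmx (sum_nat_deltar _ b_lt).
have a_lt' : (a < mixed_dim I J t m)%N by move: a_lt; rewrite set_dim_neq.
rewrite (sum_nat_deltal _ a_lt') ltnS [(m <= t)%N]leq_eqVlt.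
by rewrite -[t]/(val n) val_eqE (negPf mn).
Qed.

Lemma multi_prod_kernel I J (X : tensor R I) (U : forall n, 'M[R]_(J n, I n)) :
  multi_prod X U = kernel_prod J (fun n => nat_entry (U n)) X.
Proof.
rewrite /multi_prod -kernel_prod_delta multi_prod_upto_kernel kernel_prod_comp.
apply: eq_kernel_prod => n a b.
have a_lt : (a < mixed_dim I J d n)%N by rewrite mixed_dim_all.
by rewrite (sum_nat_deltal _ a_lt) ltn_ord.
Qed.

Lemma multi_prod_comp I J (X : tensor R I) (P : forall n, 'M[R]_(J n, I n))
    (C : forall n, 'M[R]_(I n, J n)) :
  multi_prod (multi_prod X P) C = multi_prod X (fun n => C n *m P n).
Proof.
rewrite !multi_prod_kernel kernel_prod_comp; apply: eq_kernel_prod => n a b.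
by rewrite nat_entryE mxE; apply: eq_bigr => c _; rewrite !nat_entryE.
Qed.

(** Unfolding only rearranges entries, so a tensor error can be measured in whichever mode is
    convenient. *)
Lemma frob2_unfold I n (X : tensor R I) : frob X ^+ 2 = fnorm2 (unfold X n).
Proof.
rewrite /frob sqr_sqrtr; last by apply: sumr_ge0 => i _; exact: sqr_ge0.
rewrite (sum_mode_join n); apply: eq_bigr => a _.
rewrite (reindex (fun j => enum_val (cast_ord (esym (card_cidx I n)) j))) /=.
  by apply: eq_bigr => j _; rewrite mxE.
apply: onW_bij; apply: bij_comp; first exact: enum_val_bij.
by exists (cast_ord (card_cidx I n)) => j; apply: val_inj.
Qed.

Lemma unfoldD I n (X Y : tensor R I) : unfold (X + Y) n = unfold X n + unfold Y n.
Proof. by apply/matrixP => a j; rewrite !mxE ffunE. Qed.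

Lemma unfoldB I n (X Y : tensor R I) : unfold (X - Y) n = unfold X n - unfold Y n.
Proof. by apply/matrixP => a j; rewrite !mxE !ffunE. Qed.

(** The mode product with a square matrix, in kernel form so that the result stays in [tensor R I]
    instead of a type over [set_dim]. *)
Definition mode_op I n (Q : 'M[R]_(I n)) (X : tensor R I) : tensor R I :=
  kernel_prod I (fun m => if m == n then nat_entry Q else nat_delta) X.

Lemma unfold_mode_op I n (Q : 'M[R]_(I n)) (X : tensor R I) :
  unfold (mode_op Q X) n = Q *m unfold X n.
Proof.
apply/matrixP => a j; rewrite !mxE ffunE (sum_mode_join n); apply: eq_bigr => b _.
set j' := enum_val _; rewrite mxE -/j'.
rewrite (bigD1 j') //= [X in _ + X]big1 ?addr0 => [|l lj].
  rewrite (bigD1 n) //= eqxx !mode_join_at big1 => [|m mn].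
    by rewrite mulr1 nat_entryE mulrC.
  by rewrite (negPf mn) !(mode_join_off _ _ (exist _ m mn)) /nat_delta eqxx.
have [m ne] : exists m, l m != j' m.
  by apply/existsP; rewrite -negb_forall; apply: contraNN lj => /eqfunP/ffunP ->.
rewrite (bigD1 (val m)) //= (negPf (valP m)) !mode_join_off /nat_delta.
case: eqP => [e|]; last by rewrite mul0r mulr0.
by case/eqP: ne; apply: val_inj; exact: esym e.
Qed.

(* X - Q_0...Q_t X = (X - Q_t X) + Q_t (X - Q_0...Q_(t-1) X), and the two
   summands are orthogonal. *)
Lemma multi_proj_error I (X : tensor R I) (Q : forall n, 'M[R]_(I n)) :
  (forall n, (Q n)^T = Q n) -> (forall n, Q n *m Q n = Q n) ->
  frob (X - multi_prod X Q) ^+ 2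
    <= \sum_n fnorm2 ((1%:M - Q n) *m unfold X n).
Proof.
move=> QT QQ; rewrite multi_prod_kernel.
pose f t n := if (n < t)%N then nat_entry (Q n) else nat_delta.
suff upto t : (t <= d)%N -> frob (X - kernel_prod I (f t) X) ^+ 2
    <= \sum_(n < d | (n < t)%N) fnorm2 ((1%:M - Q n) *m unfold X n).
  rewrite (eq_kernel_prod (g := f d)) => [|n a b]; last by rewrite /f ltn_ord.
  apply: (le_trans (upto d (leqnn d))).
  by rewrite big_mkcond; apply: ler_sum => n _; rewrite ltn_ord.
elim: t => [|t IHt] td.
  rewrite kernel_prod_id subrr /frob big1 ?sqrtr0 ?expr0n ?big1 // => i _.
  by rewrite ffunE expr0n.
pose n := Ordinal td.
rewrite (bigD1 n) //=.
have -> : X - kernel_prod I (f t.+1) X =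
    (X - mode_op (Q n) X) + mode_op (Q n) (X - kernel_prod I (f t) X).
  rewrite [mode_op _ (_ - _)]kernel_prodB addrA subrK kernel_prod_comp.
  congr (_ - _).
  (* In mode [n], numbered [t], the kernel [f t] is still a delta, so [Q n] survives; in the other
     modes the delta comes from [mode_op]. *)
  apply: eq_kernel_prod => m a b; rewrite /f ltnS.
  have [mn|mn] := eqVneq m n.
    by subst m; rewrite /= leqnn ltnn (sum_nat_deltar _ (ltn_ord b)).
  have -> : (m <= t)%N = (m < t)%N.
    by rewrite leq_eqVlt -[t]/(val n) val_eqE (negPf mn).
  by rewrite (sum_nat_deltal _ (ltn_ord a)).
rewrite (frob2_unfold n) unfoldD unfoldB !unfold_mode_op.
rewrite -[X in X - _]mul1mx -mulmxBl fnorm2_projD // lerD2l.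
(* The orthogonal projection [Q n] does not increase the norm, which leaves the error of the first
   [t] modes. *)
apply: (@le_trans _ _ (fnorm2 (unfold (X - kernel_prod I (f t) X) n))).
  by rewrite [leRHS](fnorm2_proj_split _ (QT n) (QQ n)) lerDr fnorm2_ge0.
rewrite -frob2_unfold (le_trans (IHt (ltnW td))) //.
rewrite le_eqVlt; apply/orP; left; apply/eqP; apply: eq_bigl => m.
by rewrite ltnS ltn_neqAle andbC.
Qed.

End TensorProducts.

Theorem theorem3p1 (R : realType) (d : nat) (I r rh : 'I_d -> nat)
    (X : tensor R I)
    (I_le : forall n, (I n <= \prod_(k < d | k != n) I k)%N)
    (rh_gt0 : forall n, (0 < rh n)%N)
    (rh_le_r : forall n, (rh n <= r n)%N)
    (r_le_I : forall n, (r n <= I n)%N)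
    (C : forall n, 'M[R]_(I n, r n)) (G : tensor R r)
    (CG_hoid : hoid rh_le_r X C G)
    (sigma : 'I_d -> nat -> R)
    (sigma_sv : forall n, singular_values (unfold X n) (sigma n)) :
  frob (X - multi_prod G C) ^+ 2
    <= \sum_(n < d)
         ((I n)%:R * (\prod_(k < d | k != n) I k)%:R
            * (4 ^+ rh n * (rh n)%:R / 3)) * sigma n (rh n) ^+ 2.
Proof.
have [C_ldeim [P CP ->]] := CG_hoid.
rewrite multi_prod_comp.
(* The Moore-Penrose equations make [C n *m P n] an orthogonal projection: symmetry is one of them,
   idempotence follows from C P C = C. *)
have proj n : (C n *m P n)^T = C n *m P n
    /\ C n *m P n *m (C n *m P n) = C n *m P n.
  by have [CPC _ CPT _] := CP n; rewrite CPT mulmxA CPC.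
apply: (le_trans (multi_proj_error X (fun n => (proj n).1) (fun n => (proj n).2))).
apply: ler_sum => n _; have [W [s [Wlead sW Cs]]] := C_ldeim n.
have := CP n; move: (C n) Cs (P n) => _ -> Pn mp.
apply: ldeim_column_error Wlead sW mp (sigma_sv n).
by rewrite rh_gt0 (leq_trans (rh_le_r n)).
Qed.
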